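(* Let $n\ge 1$ and let $A$ and $B$ be independent random subsets of $[n]=\{1,\dots,n\}$, each distributed according to the same probability distribution on the subsets of $[n]$. Let $0<\alpha\le\frac{3-\sqrt5}{2}$, and assume that $\Pr[i\in A]\le\alpha$ for every $i\in[n]$. Then \[H(A\cup B)\ \ge\ \frac{H(2\alpha-\alpha^2)}{H(\alpha)}\,H(A).\]
   Context: For a number $x\in[0,1]$, $H(x)=-x\log x-(1-x)\log(1-x)$ denotes the binary entropy function, with $H(0)=H(1)=0$. For a random variable $Z$ taking finitely many values, $H(Z)=-\sum_z \Pr[Z=z]\log\Pr[Z=z]$ denotes its Shannon entropy (with the same logarithm base). *)

(* Defs.v *)
From HB Require Import structures.
From mathcomp Require Import all_boot all_order all_algebra.
From mathcomp Require Import all_classical all_reals all_analysis.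

Set Implicit Arguments.
Unset Strict Implicit.
Unset Printing Implicit Defensive.

Import Order.TTheory GRing.Theory Num.Theory.

Local Open Scope classical_set_scope.
Local Open Scope ring_scope.

(* Subsets of a finite type carry the discrete sigma-algebra, so that a random
   subset of [T] is a random variable [{RV P >-> {set T}}]. *)
HB.instance Definition _ (T : finType) :=
  isPointed.Build {set T} (finset.set0 : {set T}).
HB.instance Definition _ (T : finType) :=
  @isMeasurable.Build default_measure_display {set T} discrete_measurable
    discrete_measurable0 discrete_measurableC discrete_measurableU.

Definition independent_rv d d1 d2 (W : measurableType d)
    (T1 : measurableType d1) (T2 : measurableType d2) (R : realType)
    (P : probability W R) (X : {RV P >-> T1}) (Y : {RV P >-> T2}) : Prop :=
  forall (U : set T1) (V : set T2), measurable U -> measurable V ->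
    P (X @^-1` U `&` Y @^-1` V) = (P (X @^-1` U) * P (Y @^-1` V))%E.

Definition identically_distributed d d' (W : measurableType d)
    (T' : measurableType d') (R : realType)
    (P : probability W R) (X Y : {RV P >-> T'}) : Prop :=
  forall U : set T', measurable U -> distribution P X U = distribution P Y U.

Definition logb (R : realType) (b x : R) : R := ln x / ln b.

(* No case distinction is needed at probability 0, since [ln 0 = 0] and the
   logarithm is multiplied by 0 there. *)
Definition binary_entropy (R : realType) (b x : R) : R :=
  - x * logb b x - (1 - x) * logb b (1 - x).

(* [Z] is a bare function, so that pointwise expressions such as
   [fun w => A w :|: B w] can be used directly; the value is meaningful when
   the level sets of [Z] are measurable. *)
Definition shannon_entropy d (W : measurableType d) (R : realType)
    (P : probability W R) (F : finType) (b : R) (Z : W -> F) : R :=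
  - \sum_(z : F) fine (P (Z @^-1` [set z])) * logb b (fine (P (Z @^-1` [set z]))).

(* Main.v *)
Require Import Defs.
From mathcomp Require Import all_boot all_order all_algebra.
From mathcomp Require Import all_classical all_reals all_analysis.
From mathcomp Require Import ring lra.

(** Reveal the elements of [n] one at a time.  Let x and y be the conditional
    probabilities that the current element is missing from A and from B given
    the past; they are independent and identically distributed, with mean at
    least m := 1 - alpha, which is at least the golden ratio conjugate phi.
    Conditioning the union on the pasts of both A and B only lowers its
    entropy, so by the chain rule it is enough to show that
      E h(xy) >= h(m^2) / h(m) * E h(x),
    where h is the binary entropy.

    The kernel Q(x, y) = x h(y) + y h(x) - h(xy) equals the sum over k >= 2 of
    (x - x^k) (y - y^k) / (k (k - 1)), hence is positive semidefinite.  By the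
    Cauchy-Schwarz and AM-GM inequalities an affine bound
      h(x^2) >= (c + s (x - m)) h(x)
    on the diagonal therefore extends to
      2 h(xy) >= (c + s (x - m)) h(y) + (c + s (y - m)) h(x),
    and taking expectations with c = h(m^2) / h(m) and s >= 0 gives the claim.
    The affine bound says that the graph of h(x^2) / h(x) lies above its tangent
    at m.  It holds because this ratio is convex on [phi, 1), and because
    h(x^2) / h(x) >= x / phi on (0, phi), where x / phi is the tangent at phi. *)

Set Implicit Arguments.
Unset Strict Implicit.
Unset Printing Implicit Defensive.

Import Order.TTheory GRing.Theory Num.Theory.

Local Open Scope classical_set_scope.
Local Open Scope ring_scope.

(** * Differentiation rules and the mean value theorem *)

Section Calculus.
Variable R : realType.
Implicit Types (f g : R -> R) (a b c x y t : R).

Lemma is_derive1_cst a x : is_derive x 1 (fun=> a) 0.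
Proof. exact: is_derive_cst. Qed.

Lemma is_derive1_id x : is_derive x 1 (fun t => t) 1.
Proof. exact: is_derive_id. Qed.

Lemma is_derive1_add f g x a b : is_derive x 1 f a -> is_derive x 1 g b ->
  is_derive x 1 (fun t => f t + g t) (a + b).
Proof. by move=> ? ?; exact: is_deriveD. Qed.

Lemma is_derive1_opp f x a : is_derive x 1 f a -> is_derive x 1 (fun t => - f t) (- a).
Proof. by move=> ?; exact: is_deriveN. Qed.

Lemma is_derive1_mul f g x a b : is_derive x 1 f a -> is_derive x 1 g b ->
  is_derive x 1 (fun t => f t * g t) (f x * b + g x * a).
Proof. by move=> ? ?; exact: is_deriveM. Qed.

Lemma is_derive1_pow f n x a : is_derive x 1 f a ->
  is_derive x 1 (fun t => f t ^+ n) (n%:R * f x ^+ n.-1 * a).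
Proof.
move=> df; have -> : (fun t => f t ^+ n) = f ^+ n by rewrite exprfctE.
exact: is_deriveX.
Qed.

Lemma is_derive1_ln_comp f x a : is_derive x 1 f a -> 0 < f x ->
  is_derive x 1 (fun t => ln (f t)) (a / f x).
Proof.
move=> df fx0; rewrite mulrC.
exact: (is_derive1_comp (is_derive1_ln fx0) df).
Qed.

Lemma is_derive1_inv f x a : is_derive x 1 f a -> 0 < f x ->
  is_derive x 1 (fun t => (f t)^-1) (- a / f x ^+ 2).
Proof.
move=> df fx0.
by have := is_deriveV (lt0r_neq0 fx0) df; rewrite /GRing.scale/= !mulNr mulrC.
Qed.

Lemma mvt f f' a b : a < b ->
  (forall x, a <= x <= b -> is_derive x 1 f (f' x)) ->
  exists2 c, a < c < b & f b - f a = f' c * (b - a).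
Proof.
move=> ab df; have [x| |c] := @MVT R f f' a b ab.
- by rewrite in_itv/= => /andP[ax xb]; apply: df; rewrite !ltW.
- apply: derivable_within_continuous => x; rewrite in_itv/= => xab.
  by have [] := df x xab.
- by rewrite in_itv/= => cab E; exists c.
Qed.

End Calculus.

(** Syntax-directed differentiation: the derivative is synthesized from the shape of the function,
    and only the positivity conditions for [ln] and inverses are left open. *)
Ltac is_der :=
  lazymatch goal with
  | |- is_derive _ _ (fun=> ?a) _ => notypeclasses refine (is_derive1_cst a _)
  | |- is_derive _ _ (fun t => t) _ => notypeclasses refine (is_derive1_id _)
  | |- is_derive _ _ (fun t => @?f t + @?g t) _ =>
      notypeclasses refine (@is_derive1_add _ f g _ _ _ _ _); is_der
  | |- is_derive _ _ (fun t => - @?f t) _ =>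
      notypeclasses refine (@is_derive1_opp _ f _ _ _); is_der
  | |- is_derive _ _ (fun t => @?f t ^+ ?n) _ =>
      notypeclasses refine (@is_derive1_pow _ f n _ _ _); is_der
  | |- is_derive _ _ (fun t => (@?f t)^-1) _ =>
      notypeclasses refine (@is_derive1_inv _ f _ _ _ _); [is_der|]
  | |- is_derive _ _ (fun t => @?f t * @?g t) _ =>
      notypeclasses refine (@is_derive1_mul _ f g _ _ _ _ _); is_der
  | |- is_derive _ _ (fun t => ln (@?f t)) _ =>
      notypeclasses refine (@is_derive1_ln_comp _ f _ _ _ _); [is_der|]
  end.

Ltac derive_as_stated :=
  notypeclasses refine (is_derive_eq _ _); [is_der|rewrite /=].

(** * Rational bounds on the logarithm *)

Section LnBounds.
Variable R : realType.
Implicit Types (c t x : R).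

(** With u = (t - 1) / (t + 1), ln t = 2 artanh u = 2 u + 2/3 u^3 + ...; these are the first two
    terms of the series. *)
Lemma ln_ge_artanh t : 1 <= t ->
  2 * ((t - 1) / (t + 1)) + 2 / 3 * ((t - 1) / (t + 1)) ^+ 3 <= ln t.
Proof.
rewrite le_eqVlt => /predU1P[<-|t1]; first by rewrite !(subrr, mul0r, ln1, expr0n)/=; lra.
pose f x : R := ln x - 2 * ((x - 1) / (x + 1)) - 2 / 3 * ((x - 1) / (x + 1)) ^+ 3.
pose f' x : R := (x - 1) ^+ 4 / (x * (x + 1) ^+ 4).
have [x|c /andP[c1 ct]] := @mvt R f f' _ _ t1.
  move=> /andP[x1 xt]; rewrite /f /f'; derive_as_stated; try lra.
  by field; lra.
rewrite {1 2}/f ln1 subrr mul0r => E.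
suff : 0 <= f' c * (t - 1) by rewrite -E !(expr0n, mul0r)/=; lra.
by rewrite mulr_ge0 ?divr_ge0 ?mulr_ge0 ?exprn_ge0//; lra.
Qed.

(** The tail of the same series after 2 u is at most the geometric sum (2/3) u^3 / (1 - u^2), which
    is the last term here. *)
Lemma ln_le_artanh t : 1 <= t ->
  ln t <= 2 * ((t - 1) / (t + 1)) + (t - 1) ^+ 3 / (6 * t * (t + 1)).
Proof.
rewrite le_eqVlt => /predU1P[<-|t1]; first by rewrite !(subrr, mul0r, ln1, expr0n)/=; lra.
pose f x : R := 2 * ((x - 1) / (x + 1)) + (x - 1) ^+ 3 / (6 * x * (x + 1)) - ln x.
pose f' x : R := (x - 1) ^+ 4 / (6 * x ^+ 2 * (x + 1) ^+ 2).
have [x|c /andP[c1 ct]] := @mvt R f f' _ _ t1.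
  move=> /andP[x1 xt]; rewrite /f /f'; derive_as_stated; try nra.
  by field; lra.
rewrite {1 2}/f ln1 subrr mul0r => E.
suff : 0 <= f' c * (t - 1) by rewrite -E !(expr0n, mul0r)/=; lra.
by rewrite mulr_ge0 ?divr_ge0 ?mulr_ge0 ?exprn_ge0//; lra.
Qed.

End LnBounds.

(** * Positive semidefiniteness of the entropy kernel *)

Section EntropyKernel.
Import numFieldNormedType.Exports.
Variable R : realType.
Implicit Types (c s x y t l : R).

Definition hnat x : R := - (x * ln x) - (1 - x) * ln (1 - x).

(* The truncated Taylor series of [- ln (1 - t)]. *)
Definition logpoly N t : R := \sum_(j < N) t ^+ j.+1 / j.+1%:R.

Lemma is_derive_logpoly N x :
  is_derive x 1 (logpoly N) (\sum_(j < N) x ^+ j).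
Proof.
elim: N => [|N IH].
  have -> : logpoly 0 = fun=> 0 by apply: funext => t; rewrite /logpoly big_ord0.
  by rewrite big_ord0; exact: is_derive1_cst.
have -> : logpoly N.+1 = fun t => logpoly N t + t ^+ N.+1 / N.+1%:R.
  by apply: funext => t; rewrite /logpoly big_ord_recr.
rewrite big_ord_recr/=; apply: is_derive1_add => //; derive_as_stated.
by field; rewrite nat1r; exact/lt0r_neq0/ltr0Sn.
Qed.

(** By the geometric sum the remainder has derivative [x ^+ N / (1 - x)], which is increasing on (0,
    1). *)
Lemma logpoly_bounds N t : 0 < t < 1 ->
  0 <= - ln (1 - t) - logpoly N t <= t ^+ N / (1 - t).
Proof.
move=> /andP[t0 t1].
pose f x : R := - ln (1 - x) - logpoly N x.
pose f' x : R := x ^+ N / (1 - x).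
have [x /andP[x0 xt]|c /andP[c0 ct]] := @mvt R f f' _ _ t0.
  rewrite /f /f'; notypeclasses refine (is_derive_eq _ _).
    apply: is_derive1_add; last by apply: is_derive1_opp; exact: is_derive_logpoly.
    by is_der; lra.
  have := subrX1 x N => E /=.
  have -> : x ^+ N = 1 - (1 - x) * \sum_(i < N) x ^+ i by lra.
  by field; lra.
rewrite /f subr0 ln1 oppr0 sub0r => E.
have E0 : logpoly N 0 = 0 by rewrite /logpoly big1// => i _; rewrite expr0n/= mul0r.
rewrite E0 oppr0 !subr0 in E; rewrite E /f'.
have cN : 0 <= c ^+ N by rewrite exprn_ge0// ltW.
apply/andP; split; first by rewrite mulr_ge0 ?divr_ge0//; lra.
rewrite -[leRHS]mulr1; apply: ler_pM; [by rewrite divr_ge0//; lra|lra| |lra].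
apply: ler_pM => //; first by rewrite invr_ge0; lra.
- by apply: lerXn2r; rewrite ?nnegrE; lra.
- by rewrite lef_pV2 ?posrE; lra.
Qed.

Lemma cvg_logpoly t : 0 < t < 1 -> logpoly^~ t @ \oo --> - ln (1 - t).
Proof.
move=> t01; have /andP[t0 t1] := t01.
have h : (fun N => - ln (1 - t) - t ^+ N / (1 - t)) @ \oo --> - ln (1 - t).
  rewrite [X in _ --> X](_ : _ = - ln (1 - t) - 0 * (1 - t)^-1); last first.
    by rewrite mul0r subr0.
  apply: cvgB; first exact: cvg_cst.
  apply: cvgM; last exact: cvg_cst.
  by apply: cvg_expr; rewrite gtr0_norm.
apply: (squeeze_cvgr _ h (@cvg_cst _ (- ln (1 - t)) _ _ _)); near=> N.
by have := logpoly_bounds N t01; lra.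
Unshelve. all: by end_near. Qed.

(** For [F t = - ln (1 - t)] this is the kernel x h(y) + y h(x) - h(xy), in which the logarithms of
    x and y cancel. Linearity in [F] allows truncating the series. *)
Definition kernel_of (F : R -> R) x y : R :=
  x * (1 - y) * F y + y * (1 - x) * F x - (1 - x * y) * F (x * y).

(* The quadratic form of the kernel on the points [x, y], evaluated at [(l, -1)]. *)
Definition kernel_form (F : R -> R) l x y : R :=
  l ^+ 2 * kernel_of F x x - 2 * l * kernel_of F x y + kernel_of F y y.

(* With u_k(x) := x - x^k, the kernel of [logpoly N.+1] is the sum of
   u_k(x) u_k(y) / (k (k - 1)) over 2 <= k <= N + 1 plus
   u_(N+2)(x) u_(N+2)(y) / (N + 1); the left-hand side is the contribution of
   the last summand to the quadratic form. *)
Lemma kernel_form_logpoly N l x y :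
  (l * (x - x ^+ N.+2) - (y - y ^+ N.+2)) ^+ 2 / N.+1%:R
  <= kernel_form (logpoly N.+1) l x y.
Proof.
elim: N => [|N IH].
  rewrite /kernel_form /kernel_of /logpoly !big_ord1 le_eqVlt; apply/orP; left.
  by apply/eqP => /=; field.
suff : (l * (x - x ^+ N.+3) - (y - y ^+ N.+3)) ^+ 2 / N.+2%:R -
    (l * (x - x ^+ N.+2) - (y - y ^+ N.+2)) ^+ 2 / N.+1%:R <=
    kernel_form (logpoly N.+2) l x y - kernel_form (logpoly N.+1) l x y.
  by move/(lerD IH); rewrite ![_ + (_ - _)]addrC !subrK.
have N1 : (0 : R) < N.+1%:R by exact: ltr0Sn.
have NE : N.+2%:R = N.+1%:R + 1 :> R by rewrite -[N.+2]addn1 natrD.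
have -> : kernel_form (logpoly N.+2) l x y - kernel_form (logpoly N.+1) l x y =
   kernel_form (fun t => t ^+ N.+2 / N.+2%:R) l x y.
  by rewrite /kernel_form /kernel_of /logpoly !(big_ord_recr N.+1)/=; ring.
rewrite /kernel_form /kernel_of NE !(exprS _ N.+2) !exprMn.
set X := x ^+ N.+2; set Y := y ^+ N.+2; set n := N.+1%:R in N1 *.
rewrite -subr_ge0.
(* The surplus is exactly the contribution of the summand k = N + 2. *)
rewrite (_ : _ - _ = (l * (x - X) - (y - Y)) ^+ 2 / (n * (n + 1))).
  by rewrite divr_ge0 ?sqr_ge0// mulr_ge0//; lra.
by field; apply/andP; split; lra.
Qed.

(** The form is linear in the values of [F], so nonnegativity for [logpoly N] passes to the limit
    term by term. *)
Lemma kernel_form_ge0 l x y : 0 < x < 1 -> 0 < y < 1 ->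
  0 <= kernel_form (fun t => - ln (1 - t)) l x y.
Proof.
move=> x01 y01; have /andP[x0 x1] := x01; have /andP[y0 y1] := y01.
have xy : 0 < x * y < 1 by nra.
have xx : 0 < x * x < 1 by nra.
have yy : 0 < y * y < 1 by nra.
have formE F : kernel_form F l x y =
    2 * l ^+ 2 * (x * (1 - x)) * F x - 2 * l * (y * (1 - x)) * F x +
    2 * (y * (1 - y)) * F y - 2 * l * (x * (1 - y)) * F y -
    l ^+ 2 * (1 - x * x) * F (x * x) + 2 * l * (1 - x * y) * F (x * y) -
    (1 - y * y) * F (y * y) by rewrite /kernel_form /kernel_of; ring.
have cvgZ k t : 0 < t < 1 -> k * logpoly N t @[N --> \oo] --> k * - ln (1 - t).
  by move=> t01; apply: cvgMl_tmp; exact: cvg_logpoly.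
apply: (@cvgr_to_ge _ \oo _ _ (fun N => kernel_form (logpoly N) l x y)).
  rewrite formE; under eq_fun do rewrite formE.
  apply: cvgB; last exact: cvgZ.
  apply: cvgD; last exact: cvgZ.
  do 2![apply: cvgB; last exact: cvgZ].
  by apply: cvgD; [apply: cvgB; exact: cvgZ|exact: cvgZ].
near=> N; have N0 : (0 < N)%N by near: N; exists 1%N.
rewrite -(prednK N0); apply: le_trans (kernel_form_logpoly N.-1 l x y).
by rewrite divr_ge0 ?sqr_ge0.
Unshelve. all: by end_near. Qed.

Lemma hnat_gt0 x : 0 < x < 1 -> 0 < hnat x.
Proof.
move=> /andP[x0 x1]; rewrite /hnat.
have l1 : ln x < 0 by apply: ln_lt0; lra.
have l2 : ln (1 - x) < 0 by apply: ln_lt0; lra.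
nra.
Qed.

Lemma kernel_hnat x y : 0 < x < 1 -> 0 < y < 1 ->
  kernel_of (fun t => - ln (1 - t)) x y = x * hnat y + y * hnat x - hnat (x * y).
Proof.
by move=> /andP[x0 x1] /andP[y0 y1]; rewrite /kernel_of /hnat lnM ?posrE//; ring.
Qed.

(* The quadratic form is taken at [l := hnat y / hnat x], the optimal weight in
   AM-GM. *)
Lemma hnat_mul_ge c s m x y : 0 < x < 1 -> 0 < y < 1 ->
  (forall t, 0 < t < 1 -> (c + s * (t - m)) * hnat t <= hnat (t * t)) ->
  (c + s * (x - m)) * hnat y + (c + s * (y - m)) * hnat x <= 2 * hnat (x * y).
Proof.
move=> x01 y01 diag; have hx := hnat_gt0 x01; have hy := hnat_gt0 y01.
have := kernel_form_ge0 (hnat y / hnat x) x01 y01.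
rewrite /kernel_form !kernel_hnat//.
have dx := diag x x01; have dy := diag y y01 => F.
(* This scaling makes the form affine in the two diagonal ratios [hnat (t * t) / hnat t], which are
   then bounded by [diag]. *)
have : 0 <= hnat x / hnat y * (
    (hnat y / hnat x) ^+ 2 * (x * hnat x + x * hnat x - hnat (x * x)) -
    2 * (hnat y / hnat x) * (x * hnat y + y * hnat x - hnat (x * y)) +
    (y * hnat y + y * hnat y - hnat (y * y))).
  by rewrite mulr_ge0// divr_ge0// ltW.
rewrite (_ : hnat x / hnat y * _ = hnat y * (2 * x - hnat (x * x) / hnat x)
   - 2 * (x * hnat y + y * hnat x - hnat (x * y))
   + hnat x * (2 * y - hnat (y * y) / hnat y)); last by field; lra.
have : c + s * (x - m) <= hnat (x * x) / hnat x by rewrite ler_pdivlMr.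
have : c + s * (y - m) <= hnat (y * y) / hnat y by rewrite ler_pdivlMr.
move: (hnat _ / _) (hnat _ / _) => u v hu hv; nra.
Qed.

End EntropyKernel.

(** * The diagonal bound below the golden ratio conjugate *)

Section GoldenRatio.
Variable R : realType.
Implicit Types (f : R -> R) (a b c t x z : R).

Lemma mvt_deriv_gt0 f f' a b : a < b -> f a < f b ->
  (forall x, a <= x <= b -> is_derive x 1 f (f' x)) ->
  exists2 c, a < c < b & 0 < f' c.
Proof.
move=> ab fab /(mvt ab)[c cab E]; exists c => //.
by rewrite -(@pmulr_lgt0 _ (b - a)) ?subr_gt0// -E subr_gt0.
Qed.

Lemma mvt_deriv_lt0 f f' a b : a < b -> f b < f a ->
  (forall x, a <= x <= b -> is_derive x 1 f (f' x)) ->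
  exists2 c, a < c < b & f' c < 0.
Proof.
move=> ab fab /(mvt ab)[c cab E]; exists c => //.
by rewrite -(@pmulr_llt0 _ (b - a)) ?subr_gt0// -E subr_lt0.
Qed.

Lemma ln_ge_sub_inv x : 0 < x -> 1 - x^-1 <= ln x.
Proof.
move=> x0; have := @le_ln1Dx R (x^-1 - 1); rewrite addrCA subrr addr0 lnV ?posrE//.
have : 0 < x^-1 by rewrite invr_gt0.
by move=> ? /(_ ltac:(lra)); lra.
Qed.

Lemma ln2_bounds : 11 / 16 <= ln (2 : R) <= 25 / 36.
Proof.
have e1 : (2 - 1) / (2 + 1) = 3^-1 :> R by field.
have e2 : (2 - 1) ^+ 3 / (6 * 2 * (2 + 1)) = 36^-1 :> R by field.
have := @ln_ge_artanh R 2 ltac:(lra); have := @ln_le_artanh R 2 ltac:(lra).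
by rewrite e1 e2; lra.
Qed.

Variable phi : R.
Hypotheses (phi_gt0 : 0 < phi) (phi_sqr : phi ^+ 2 = 1 - phi).

(** Both bounds are ratios of consecutive Fibonacci numbers, the convergents of [phi]. *)
Lemma golden_bounds : 21 / 34 < phi < 13 / 21.
Proof.
apply/andP; split; rewrite ltNge; apply/negP => h.
  have : phi * phi <= phi * (21 / 34) by rewrite ler_pM2l.
  move: phi_sqr; rewrite expr2; lra.
have : phi * (13 / 21) <= phi * phi by rewrite ler_pM2l.
move: phi_sqr; rewrite expr2; lra.
Qed.

(** At [phi] every logarithm involved is a multiple of [ln phi], so evaluations there become
    polynomial identities in [phi]. *)
Lemma ln_1sub_golden : ln (1 - phi) = 2 * ln phi.
Proof. by rewrite -phi_sqr lnXn// mulr_natl. Qed.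

Lemma ln_1add_golden : ln (1 + phi) = - ln phi.
Proof.
rewrite -lnV ?posrE//; congr ln; apply: (mulIf (lt0r_neq0 phi_gt0)).
by move: phi_sqr; rewrite mulVf ?lt0r_neq0//; lra.
Qed.

(* [p0 t = phi * hnat (t * t) - t * hnat t], and p1, p2, p3 are its successive
   derivatives; the third one is rational. *)
Let k := 2 * phi - 1.
Let p0 t := - k * t ^+ 2 * ln t + (- phi + t - (1 - phi) * t ^+ 2) * ln (1 - t)
  - phi * (1 - t ^+ 2) * ln (1 + t).
Let p1 t := - 2 * k * t * ln t + (1 - 2 * (1 - phi) * t) * ln (1 - t)
  + 2 * phi * t * ln (1 + t).
Let p2 t := - 2 * k * ln t - 2 * k - 2 * (1 - phi) * ln (1 - t)
  - (1 - 2 * (1 - phi) * t) / (1 - t) + 2 * phi * ln (1 + t)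
  + 2 * phi * t / (1 + t).
Let g t := 3 * t - 2 * k - 4 * phi * t ^+ 2 - t ^+ 3.
Let p3 t := g t / (t * (1 - t) ^+ 2 * (1 + t) ^+ 2).

Let dp0 t : 0 < t < 1 -> is_derive t 1 p0 (p1 t).
Proof.
move=> /andP[t0 t1]; rewrite /p0 /p1 /k; derive_as_stated; try lra.
by field; apply/and3P; split; lra.
Qed.

Let dp1 t : 0 < t < 1 -> is_derive t 1 p1 (p2 t).
Proof.
move=> /andP[t0 t1]; rewrite /p1 /p2 /k; derive_as_stated; try lra.
by field; apply/and3P; split; lra.
Qed.

Let dp2 t : 0 < t < 1 -> is_derive t 1 p2 (p3 t).
Proof.
move=> /andP[t0 t1]; rewrite /p2 /p3 /g /k; derive_as_stated; try lra.
by field; apply/and3P; split; lra.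
Qed.

Let p0_golden : p0 phi = 0.
Proof.
rewrite /p0 /k ln_1sub_golden ln_1add_golden phi_sqr.
by have := phi_sqr; rewrite expr2 => /(congr1 (fun u => u * ln phi)); lra.
Qed.

Let p1_golden : p1 phi = 0.
Proof.
rewrite /p1 /k ln_1sub_golden ln_1add_golden.
by have := phi_sqr; rewrite expr2 => /(congr1 (fun u => u * ln phi)); lra.
Qed.

(** For these t, [- ln t >= 24 / 5], while [k > 4 / 17]; so [- k * t ^+ 2 * ln t] exceeds t^2 and
    outweighs the rest of [p0], whose first-order parts cancel. The logarithmic term dominates [p1]
    likewise. *)
Let p01_small t : 0 < t <= 2 ^- 7 -> 0 < p0 t /\ 0 < p1 t.
Proof.
move=> /andP[t0 td]; have /andP[f1 f2] := golden_bounds.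
have lt : ln t <= - (24 / 5).
  apply: (@le_trans _ _ (ln (2 ^- 7))); first by rewrite ler_ln ?posrE.
  rewrite lnV ?posrE// lnXn//; have := ln2_bounds; lra.
have {td} tb : t <= 1 / 128 by move: td; rewrite !exprS expr0; lra.
have l1 : ln (1 - t) <= - t by have := @le_ln1Dx R (- t) ltac:(lra); lra.
have l2 : - (11 / 10) * t <= ln (1 - t).
  apply: le_trans (ln_ge_sub_inv _); last lra.
  have -> : 1 - (1 - t)^-1 = - t / (1 - t) by field; lra.
  by rewrite ler_pdivlMr; nra.
have l3 : ln (1 + t) <= t by have := @le_ln1Dx R t ltac:(lra); lra.
have l4 : 0 <= ln (1 + t) by apply: ln_ge0; lra.
rewrite /p0 /p1 /k; split.
  have h1 : (2 * phi - 1) * t ^+ 2 * (24 / 5) <= - (2 * phi - 1) * t ^+ 2 * ln t.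
    have : 0 <= (2 * phi - 1) * t ^+ 2 by nra.
    nra.
  have h2 : (phi - t + (1 - phi) * t ^+ 2) * t <= (- phi + t - (1 - phi) * t ^+ 2) * ln (1 - t).
    have : 0 <= phi - t + (1 - phi) * t ^+ 2 by nra.
    nra.
  have h3 : phi * (1 - t ^+ 2) * ln (1 + t) <= phi * (1 - t ^+ 2) * t.
    have : 0 <= phi * (1 - t ^+ 2) by nra.
    nra.
  have : 0 < t ^+ 2 by nra.
  nra.
have h1 : 2 * (2 * phi - 1) * t * (24 / 5) <= - 2 * (2 * phi - 1) * t * ln t.
  have : 0 <= (2 * phi - 1) * t by nra.
  nra.
have h2 : ln (1 - t) <= (1 - 2 * (1 - phi) * t) * ln (1 - t).
  have : 0 <= (1 - phi) * t * (- ln (1 - t)) by rewrite !mulr_ge0//; lra.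
  lra.
have h3 : 0 <= 2 * phi * t * ln (1 + t) by rewrite !mulr_ge0//; lra.
nra.
Qed.

Let g_concave x t : 0 < x -> x < t -> t < phi -> 0 < g x -> 0 < g t.
Proof.
move=> x0 xt tp gx; have /andP[f1 f2] := golden_bounds.
have gp : 0 < g phi by rewrite /g /k; nra.
rewrite -(@pmulr_rgt0 _ (phi - x)) ?subr_gt0; last exact: lt_trans tp.
(* Concavity made explicit: the chord through x and [phi] plus a positive remainder. *)
have -> : (phi - x) * g t = (phi - t) * g x + (t - x) * g phi +
    (phi - x) * (t - x) * (phi - t) * (4 * phi + x + t + phi) by rewrite /g; ring.
rewrite -subr_gt0 in tp; rewrite -subr_gt0 in xt.
by rewrite !addr_gt0 ?mulr_gt0//; lra.
Qed.

Lemma hnat_sqr_ge_below_golden x : 0 < x < phi -> x * hnat x <= phi * hnat (x * x).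
Proof.
move=> /andP[x0 xp]; have /andP[f1 f2] := golden_bounds.
rewrite -subr_ge0 (_ : _ - _ = p0 x); last first.
  rewrite /p0 /hnat lnM ?posrE// (_ : 1 - x * x = (1 - x) * (1 + x)); last by ring.
  by rewrite lnM ?posrE; [rewrite /k; ring|lra|lra].
rewrite leNgt; apply/negP => px.
(* Were [p0 x < 0], the zeros of p0 and p1 at phi and their positivity near 0
   would force [p3] to be positive somewhere and negative further right, which
   the concavity of [g] together with [0 < g phi] excludes. *)
pose d : R := 2 ^- 7.
have d0 : 0 < d by rewrite invr_gt0 exprn_gt0.
have [p0d p1d] := @p01_small d ltac:(by rewrite d0 lexx).
have dx : d < x.
  rewrite ltNge; apply/negP => xd.
  by have [] := @p01_small x ltac:(by rewrite x0 xd); lra.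
(* Signs obtained, from left to right: [p1] is negative at a and positive at b; [p2] is negative,
   positive, negative at c1, c2, c3; [p3] is positive at e1 and negative at e2. *)
have [a /andP[da ax] pa] := mvt_deriv_lt0 dx (lt_trans px p0d)
  (fun t ht => @dp0 t ltac:(move/andP: ht => [? ?]; apply/andP; split; lra)).
have [b /andP[xb bp] pb] := @mvt_deriv_gt0 p0 p1 _ _ xp ltac:(by rewrite p0_golden)
  (fun t ht => @dp0 t ltac:(move/andP: ht => [? ?]; apply/andP; split; lra)).
have [c1 /andP[dc1 c1a] pc1] := mvt_deriv_lt0 da (lt_trans pa p1d)
  (fun t ht => @dp1 t ltac:(move/andP: ht => [? ?]; apply/andP; split; lra)).
have [c2 /andP[ac2 c2b] pc2] := mvt_deriv_gt0 (lt_trans ax xb) (lt_trans pa pb)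
  (fun t ht => @dp1 t ltac:(move/andP: ht => [? ?]; apply/andP; split; lra)).
have [c3 /andP[bc3 c3p] pc3] := @mvt_deriv_lt0 p1 p2 _ _ bp ltac:(by rewrite p1_golden)
  (fun t ht => @dp1 t ltac:(move/andP: ht => [? ?]; apply/andP; split; lra)).
have [e1 /andP[c1e1 e1c2] pe1] := mvt_deriv_gt0 (lt_trans c1a ac2) (lt_trans pc1 pc2)
  (fun t ht => @dp2 t ltac:(move/andP: ht => [? ?]; apply/andP; split; lra)).
have [e2 /andP[c2e2 e2c3] pe2] := mvt_deriv_lt0 (lt_trans c2b bc3) (lt_trans pc3 pc2)
  (fun t ht => @dp2 t ltac:(move/andP: ht => [? ?]; apply/andP; split; lra)).
have den t : 0 < t < 1 -> 0 < (t * (1 - t) ^+ 2 * (1 + t) ^+ 2)^-1.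
  by move=> /andP[t0 t1]; rewrite invr_gt0 !mulr_gt0 ?exprn_gt0//; lra.
have ge1 : 0 < g e1 by rewrite -(pmulr_lgt0 _ (den e1 _))//; lra.
have ge2 : g e2 < 0 by rewrite -(pmulr_llt0 _ (den e2 _))//; lra.
have : 0 < g e2 by apply: (@g_concave e1) => //; lra.
lra.
Qed.

End GoldenRatio.

(** * Estimates behind the convexity of the entropy ratio *)

Section Convexity.
Variable R : realType.
Implicit Types (a b c p s t x y : R).

(** This is [(2 - y) * (1 - y) * F a b p y], with [F] as below, at the least admissible a, b and p;
    the companion lemma takes the greatest b. The range is that of y = 1 - x for x at least 21/34. A
    constant lower bound on the cofactor of [y ^+ 3] leaves a cubic. *)
Lemma poly_endpoint_lo y : 0 <= y <= 13 / 34 ->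
  0 <= 11 / 4 - 1341 / 112 * y + 915 / 56 * y ^+ 2 - 3125 / 448 * y ^+ 3
       - 1459 / 224 * y ^+ 4 + 1579 / 224 * y ^+ 5 - 33 / 56 * y ^+ 6.
Proof.
move=> /andP[y0 y1].
have y2 : 0 <= y ^+ 2 by exact: sqr_ge0.
have h : - 17 / 2 <= - 3125 / 448 - 1459 / 224 * y + 1579 / 224 * y ^+ 2 - 33 / 56 * y ^+ 3 by nra.
have h3 : 0 <= 11 / 4 - 1341 / 112 * y + 915 / 56 * y ^+ 2 - 17 / 2 * y ^+ 3 by nra.
have y3 : 0 <= y ^+ 3 by exact: exprn_ge0.
have := ler_wpM2l y3 h; lra.
Qed.

Lemma poly_endpoint_hi y : 0 <= y <= 13 / 34 ->
  0 <= 25 / 9 - 425 / 36 * y + 91 / 6 * y ^+ 2 - 929 / 144 * y ^+ 3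
       - 401 / 72 * y ^+ 4 + 479 / 72 * y ^+ 5 - 5 / 8 * y ^+ 6.
Proof.
move=> /andP[y0 y1].
have y2 : 0 <= y ^+ 2 by exact: sqr_ge0.
have h : - 77 / 10 <= - 929 / 144 - 401 / 72 * y + 479 / 72 * y ^+ 2 - 5 / 8 * y ^+ 3 by nra.
have h3 : 0 <= 25 / 9 - 425 / 36 * y + 91 / 6 * y ^+ 2 - 77 / 10 * y ^+ 3 by nra.
have y3 : 0 <= y ^+ 3 by exact: exprn_ge0.
have := ler_wpM2l y3 h; lra.
Qed.

(* With [y := 1 - x], [a := - ln y], [b := ln (2 - y)], [p := - ln (1 - y) / y], the
   numerator of the second derivative of [2 * x - hnat (x * x) / hnat x] is,
   up to the factor [y ^+ 2] and a nonpositive term in [a ^+ 2], equal to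
   [- F a b p y]. *)
Let F a b p y := a * (2 * y * p ^+ 2 + b * (4 * p - (2 - y) / (1 - y))
    - y * p * ((2 - 3 * y) / (2 - y)))
  - (2 * y * ((1 - y) ^+ 2 / (2 - y)) * p ^+ 2 + 2 * y * b * p ^+ 2 + (2 - y) * b * p).

(** [F] is affine in b, so it suffices to check both ends of the range of b. *)
Lemma F_base_ge0 b y : 0 < y <= 13 / 34 ->
  11 / 16 - 4 / 7 * y <= b <= 25 / 36 - y / 2 ->
  0 <= F (2 - 11 / 4 * y) b (1 + y / 2) y.
Proof.
move=> /andP[y0 y1] /andP[b0 b1].
have G0 : 0 <= (2 - y) * (1 - y) * F (2 - 11 / 4 * y) (11 / 16 - 4 / 7 * y) (1 + y / 2) y.
  apply: le_trans (@poly_endpoint_lo y ltac:(lra)) _.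
  by rewrite le_eqVlt /F; apply/orP; left; apply/eqP; field; lra.
have G1 : 0 <= (2 - y) * (1 - y) * F (2 - 11 / 4 * y) (25 / 36 - y / 2) (1 + y / 2) y.
  apply: le_trans (@poly_endpoint_hi y ltac:(lra)) _.
  by rewrite le_eqVlt /F; apply/orP; left; apply/eqP; field; lra.
have q0 : 0 < (2 - y) * (1 - y) by rewrite mulr_gt0//; lra.
rewrite pmulr_rge0// in G0; rewrite pmulr_rge0// in G1.
have d0 : 0 < 25 / 36 - y / 2 - (11 / 16 - 4 / 7 * y) by lra.
rewrite -(pmulr_rge0 _ d0).
rewrite [X in 0 <= X](_ : _ = 
  (25 / 36 - y / 2 - b) *
    F (2 - 11 / 4 * y) (11 / 16 - 4 / 7 * y) (1 + y / 2) y +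
  (b - (11 / 16 - 4 / 7 * y)) * F (2 - 11 / 4 * y) (25 / 36 - y / 2) (1 + y / 2) y).
  by rewrite addr_ge0// mulr_ge0//; lra.
by rewrite /F; ring.
Qed.

(** Monotonicity reduces to the base values: [K] is the coefficient of a, and once a is lowered to
    [a1], the change from [p1] to p is [(p - p1) * D]. *)
Lemma F_ge0 a b p y : 0 < y <= 13 / 34 -> 2 - 11 / 4 * y <= a ->
  11 / 16 - 4 / 7 * y <= b <= 25 / 36 - y / 2 -> 1 + y / 2 <= p ->
  0 <= F a b p y.
Proof.
move=> y01 a0 b01 p0; have base := F_base_ge0 y01 b01.
have /andP[y0 y1] := y01; have /andP[b0 b1] := b01.
have v1 : (2 - 3 * y) / (2 - y) <= 1 - y by rewrite ler_pdivrMr; nra.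
have v2 : (1 - y) ^+ 2 / (2 - y) <= (1 - y) / 2 by rewrite ler_pdivrMr; nra.
have v3 : (2 - y) / (1 - y) <= 4 by rewrite ler_pdivrMr; lra.
have pge : 1 <= p by lra.
move: base; rewrite /F.
set u := (2 - 3 * y) / (2 - y) in v1 *; set w := (1 - y) ^+ 2 / (2 - y) in v2 *.
set v := (2 - y) / (1 - y) in v3 *.
set a1 := 2 - 11 / 4 * y in a0 *; set p1 := 1 + y / 2 in p0 * => base.
have p1ge : 1 <= p1 by rewrite /p1; lra.
have a1ge : 0 <= a1 by rewrite /a1; lra.
have c1 : 0 <= y * p by rewrite mulr_ge0; lra.
have K : 0 <= 2 * y * p ^+ 2 + b * (4 * p - v) - y * p * u.
  have c2 : 0 <= y * p * (2 * p - u) by rewrite mulr_ge0//; lra.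
  have c3 : 0 <= b * (4 * p - v) by rewrite mulr_ge0//; lra.
  lra.
have aK := ler_wpM2r K a0.
have c4 : 0 <= a1 - b - w by rewrite /a1; lra.
have c5 : 0 <= y * (p + p1 - 2) * (a1 - b - w) by rewrite !mulr_ge0//; lra.
have c6 : 0 <= a1 * y * (1 - y - u) by rewrite !mulr_ge0//; lra.
have c7 : 0 <= y * ((1 - y) / 2 - w) by rewrite mulr_ge0//; lra.
have c8 : 0 <= 4 * y * (a1 - b - (1 - y) / 2) + 4 * a1 * b - a1 * y * (1 - y) - (2 - y) * b.
  rewrite /a1; nra.
have D : 0 <= 2 * y * (p + p1) * (a1 - b - w) + 4 * a1 * b - a1 * y * u - (2 - y) * b.
  lra.
have := mulr_ge0 (_ : 0 <= p - p1) D; rewrite subr_ge0 => /(_ p0).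
lra.
Qed.

(** The tangent at y = 4/11, rounded down using that 11/4 exceeds e. *)
Lemma ln_lower_tangent y : 0 < y -> 2 - 11 / 4 * y <= - ln y.
Proof.
move=> y0.
have h : 1 <= ln (11 / 4 : R).
  apply: le_trans (@ln_ge_artanh R (11 / 4) _); last by lra.
  have -> : (11 / 4 - 1) / (11 / 4 + 1) = 7 / 15 :> R by field.
  by rewrite !exprS expr0; lra.
have := @le_ln1Dx R (11 / 4 * y - 1) ltac:(lra).
by rewrite addrCA subrr addr0 lnM ?posrE//; lra.
Qed.

Lemma ln_1sub_bound y : 0 < y < 1 -> y * (1 + y / 2) <= - ln (1 - y).
Proof.
move=> /andP[y0 y1]; rewrite -lnV ?posrE; last lra.
have y1' : 1 <= (1 - y)^-1 by rewrite invr_ge1; [lra|rewrite unitfE; lra|lra].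
apply: le_trans (ln_ge_artanh y1').
have -> : ((1 - y)^-1 - 1) / ((1 - y)^-1 + 1) = y / (2 - y).
  by field; apply/andP; split; lra.
have h : 0 <= y / (2 - y) by rewrite divr_ge0; lra.
have h3 : 0 <= (y / (2 - y)) ^+ 3 by exact: exprn_ge0.
suff : y * (1 + y / 2) <= 2 * (y / (2 - y)) by lra.
by rewrite mulrA ler_pdivlMr; nra.
Qed.

Lemma ln_2sub_bounds y : 0 <= y <= 13 / 34 ->
  11 / 16 - 4 / 7 * y <= ln (2 - y) <= 25 / 36 - y / 2.
Proof.
move=> /andP[y0 y1]; have /andP[l0 l1] := ln2_bounds R.
have t0 : 0 < 2 / (2 - y) by rewrite divr_gt0; lra.
have E : ln (2 - y) = ln 2 - ln (2 / (2 - y)).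
  by rewrite ln_div ?posrE; [ring|lra|lra].
have h1 : y / 2 <= ln (2 / (2 - y)).
  apply: le_trans (ln_ge_sub_inv t0); rewrite invf_div; lra.
have t1 : 1 <= 2 / (2 - y) by rewrite ler_pdivlMr; lra.
have h2 : ln (2 / (2 - y)) <= 4 / 7 * y.
  apply: le_trans (ln_le_artanh t1) _.
  have -> : 2 * ((2 / (2 - y) - 1) / (2 / (2 - y) + 1)) +
      (2 / (2 - y) - 1) ^+ 3 / (6 * (2 / (2 - y)) * (2 / (2 - y) + 1))
    = (24 * y * (2 - y) + y ^+ 3) / (12 * (2 - y) * (4 - y)).
    by field; apply/andP; split; lra.
  rewrite ler_pdivrMr; last by rewrite !mulr_gt0//; lra.
  have : 0 <= y * (13 / 34 - y) by rewrite mulr_ge0//; lra.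
  nra.
by rewrite E; lra.
Qed.

End Convexity.

(** * The tangent bound for the entropy ratio *)

Section EntropyRatio.
Variable R : realType.
Implicit Types (b c m s t x : R).

(* [hnat (x * x) / hnat x = 2 * x - J x / W x]. *)
Let J x : R := (1 - x) * ln (1 - x) + (1 + x) * ln (1 + x).
Let W x : R := - ln (1 - x) - x * ln x / (1 - x).
Let dJ x : R := ln (1 + x) - ln (1 - x).
Let ddJ x : R := (1 + x)^-1 + (1 - x)^-1.
Let dW x : R := - ln x / (1 - x) ^+ 2.
Let ddW x : R := - (x * (1 - x) ^+ 2)^-1 - 2 * ln x / (1 - x) ^+ 3.
Let rho x := J x / W x.
Let drho x := (dJ x * W x - J x * dW x) / W x ^+ 2.
Let ddrho x := ((ddJ x * W x - J x * ddW x) * W x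
  - 2 * (dJ x * W x - J x * dW x) * dW x) / W x ^+ 3.

Let is_derive_J x : 0 < x < 1 -> is_derive x 1 J (dJ x).
Proof.
move=> /andP[x0 x1]; rewrite /J /dJ; derive_as_stated; try lra.
by field; apply/andP; split; lra.
Qed.

Let is_derive_dJ x : 0 < x < 1 -> is_derive x 1 dJ (ddJ x).
Proof.
by move=> /andP[x0 x1]; rewrite /dJ /ddJ; derive_as_stated; lra.
Qed.

Let is_derive_W x : 0 < x < 1 -> is_derive x 1 W (dW x).
Proof.
move=> /andP[x0 x1]; rewrite /W /dW; derive_as_stated; try lra.
by field; apply/andP; split; lra.
Qed.

Let is_derive_dW x : 0 < x < 1 -> is_derive x 1 dW (ddW x).
Proof.
move=> /andP[x0 x1]; rewrite /dW /ddW; derive_as_stated; try lra.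
  by rewrite exprn_gt0//; lra.
by field; apply/andP; split; lra.
Qed.

Let hnatW x : 0 < x < 1 -> hnat x = (1 - x) * W x.
Proof. by move=> /andP[x0 x1]; rewrite /hnat /W; field; lra. Qed.

Let W_gt0 x : 0 < x < 1 -> 0 < W x.
Proof.
move=> x01; have := hnat_gt0 x01; rewrite hnatW// pmulr_rgt0//.
by move/andP: x01 => [_]; lra.
Qed.

Let hnat_sqrE x : 0 < x < 1 -> hnat (x * x) = (2 * x - rho x) * hnat x.
Proof.
move=> x01; have W0 := W_gt0 x01; have /andP[x0 x1] := x01.
rewrite {2}/hnat (_ : (2 * x - rho x) * _ = 2 * x * hnat x - (1 - x) * J x); last first.
  by rewrite -/(hnat x) hnatW// /rho; field; lra.
rewrite /hnat /J (_ : 1 - x * x = (1 - x) * (1 + x)); last by ring.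
by rewrite !lnM ?posrE; [ring|lra|lra|lra|lra].
Qed.

Let is_derive_rho x : 0 < x < 1 -> is_derive x 1 rho (drho x).
Proof.
move=> x01; have W0 := W_gt0 x01; rewrite /rho.
notypeclasses refine (is_derive_eq _ _).
  notypeclasses refine (is_derive1_mul (is_derive_J x01) _).
  exact: (is_derive1_inv (is_derive_W x01)).
by rewrite /drho; field; lra.
Qed.

Let is_derive_drho x : 0 < x < 1 -> is_derive x 1 drho (ddrho x).
Proof.
move=> x01; have W0 := W_gt0 x01; rewrite /drho.
notypeclasses refine (is_derive_eq _ _).
  notypeclasses refine (is_derive1_mul _ _).
    notypeclasses refine (is_derive1_add _ _).
      exact: (is_derive1_mul (is_derive_dJ x01) (is_derive_W x01)).
    apply: is_derive1_opp.
    exact: (is_derive1_mul (is_derive_J x01) (is_derive_dW x01)).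
  notypeclasses refine (is_derive1_inv _ _); last by rewrite exprn_gt0.
  exact: (is_derive1_pow 2 (is_derive_W x01)).
by rewrite /ddrho /=; field; lra.
Qed.

(** Concavity of [rho], hence convexity of the entropy ratio, on an interval that starts just below
    [phi]. *)
Let ddrho_le0 x : 21 / 34 <= x < 1 -> ddrho x <= 0.
Proof.
move=> /andP[x0 x1]; have x01 : 0 < x < 1 by apply/andP; split; lra.
have W0 := W_gt0 x01; rewrite /ddrho pmulr_lle0; last by rewrite invr_gt0 exprn_gt0.
pose y := 1 - x; pose a := - ln y; pose b := ln (2 - y); pose p := - ln (1 - y) / y.
have y0 : 0 < y <= 13 / 34 by rewrite /y; apply/andP; split; lra.
have /andP[y1 y2] := y0.
have pl : 1 + y / 2 <= p.
  by rewrite /p ler_pdivlMr// mulrC; apply: ln_1sub_bound; lra.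
have := F_ge0 y0 (ln_lower_tangent y1) (@ln_2sub_bounds R y ltac:(lra)) pl.
rewrite -/a -/b => F0.
have xE : x = 1 - y by rewrite /y; ring.
have lx : ln x = - (p * y) by rewrite /p xE mulfVK ?opprK//; lra.
have l1x : ln (1 - x) = - a by rewrite /a opprK.
have lx1 : ln (1 + x) = b by rewrite /b xE; congr ln; ring.
rewrite -(@pmulr_rle0 _ (y ^+ 2)) ?exprn_gt0//.
set f := (X in 0 <= X) in F0.
rewrite [leLHS](_ : _ = - (y ^+ 2 * a ^+ 2 / ((2 - y) * (1 - y))) - f).
  have : 0 <= y ^+ 2 * a ^+ 2 / ((2 - y) * (1 - y)).
    by apply: divr_ge0; apply: mulr_ge0; rewrite ?sqr_ge0//; lra.
  lra.
rewrite /f /W /J /dJ /ddJ /dW /ddW lx l1x lx1 xE.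
clearbody a b p.
by field; apply/and3P; split; lra.
Qed.

Let drho_decr x t : 21 / 34 <= x -> x <= t -> t < 1 -> drho t <= drho x.
Proof.
move=> x0; rewrite le_eqVlt => /predU1P[->//|xt] t1.
have [c /andP[xc ct] E] := mvt xt (fun u hu => @is_derive_drho u
  ltac:(move/andP: hu => [? ?]; apply/andP; split; lra)).
rewrite -subr_le0 E mulr_le0_ge0//; last lra.
by apply: ddrho_le0; lra.
Qed.

Let rho_tangent m x : 21 / 34 <= m < 1 -> 21 / 34 <= x < 1 ->
  rho x <= rho m + drho m * (x - m).
Proof.
move=> /andP[m0 m1] /andP[x0 x1]; have [xm|mx|->] := ltgtP x m; last lra.
- have [c /andP[xc cm] E] := mvt xm (fun u hu => @is_derive_rho u
    ltac:(move/andP: hu => [? ?]; apply/andP; split; lra)).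
  have : drho m <= drho c by apply: drho_decr; lra.
  have d0 : 0 <= m - x by lra.
  by move/(ler_wpM2r d0); rewrite -E; lra.
- have [c /andP[mc cx] E] := mvt mx (fun u hu => @is_derive_rho u
    ltac:(move/andP: hu => [? ?]; apply/andP; split; lra)).
  have : drho c <= drho m by apply: drho_decr; lra.
  have d0 : 0 <= x - m by lra.
  by move/(ler_wpM2r d0); rewrite -E; lra.
Qed.

Variable phi : R.
Hypotheses (phi_gt0 : 0 < phi) (phi_sqr : phi ^+ 2 = 1 - phi).

Let golden01 : 0 < phi < 1.
Proof. by have /andP[? ?] := golden_bounds phi_gt0 phi_sqr; lra. Qed.

Let golden_inv : (1 - phi)^-1 = 2 + phi.
Proof.
have /andP[p0 p1] := golden01; have := phi_sqr; rewrite expr2 => E.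
have h : 1 - phi != 0 by lra.
by apply: (mulfI h); rewrite divff//; lra.
Qed.

Let JW_golden : J phi = (1 - 3 * phi) * ln phi /\ W phi = - (3 + phi) * ln phi.
Proof.
rewrite /J /W ln_1sub_golden// ln_1add_golden// golden_inv.
have := phi_sqr; rewrite expr2 => /(congr1 (fun u => u * ln phi)) E.
by split; lra.
Qed.

Let rho_golden : rho phi = 2 * phi - 1.
Proof.
have W0 := W_gt0 golden01.
apply: (mulIf (lt0r_neq0 W0)); rewrite divfK ?lt0r_neq0//.
have [-> ->] := JW_golden.
have := phi_sqr; rewrite expr2 => /(congr1 (fun u => u * ln phi)) E.
by lra.
Qed.

Let drho_golden : drho phi = 1 - phi.
Proof.
have W0 := W_gt0 golden01; have W2 : W phi ^+ 2 != 0 by rewrite expf_neq0 ?lt0r_neq0.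
apply: (mulIf W2); rewrite divfK//; have [-> ->] := JW_golden.
rewrite /dJ /dW ln_1sub_golden// ln_1add_golden// -exprVn golden_inv.
have := phi_sqr; rewrite expr2 => E.
have E3 : phi * phi * phi = 2 * phi - 1.
  by rewrite E mulrBl mul1r E; ring.
have E4 : phi * phi * phi * phi = 2 - 3 * phi by rewrite E3 mulrBl -mulrA E; ring.
have L2 k : phi * phi * k = (1 - phi) * k by rewrite E.
have L3 k : phi * phi * phi * k = (2 * phi - 1) * k by rewrite E3.
have := L2 (ln phi ^+ 2); have := L3 (ln phi ^+ 2).
by lra.
Qed.

Lemma hnat_sqr_tangent m : phi <= m < 1 ->
  exists2 s, 0 <= s & forall t, 0 < t < 1 ->
    (hnat (m * m) / hnat m + s * (t - m)) * hnat t <= hnat (t * t).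
Proof.
move=> /andP[pm m1]; have /andP[p0 p1] := golden_bounds phi_gt0 phi_sqr.
have m01 : 0 < m < 1 by apply/andP; split; lra.
have dm : drho m <= 1 - phi by rewrite -drho_golden; apply: drho_decr => //; lra.
(* The slope of the ratio at m; it is at least [1 + phi], the slope at [phi]. *)
exists (2 - drho m) => [|t t01]; first by lra.
have ht := hnat_gt0 t01; have /andP[t0 t1] := t01.
rewrite (_ : hnat (m * m) / hnat m = 2 * m - rho m); last first.
  by rewrite hnat_sqrE// mulfK// lt0r_neq0// hnat_gt0.
have [tp|pt] := ltP t phi; last first.
  rewrite hnat_sqrE//; apply: ler_wpM2r; first exact: ltW.
  have := @rho_tangent m t ltac:(lra) ltac:(lra); lra.
(* At [phi] the tangent at m is at most the ratio's value 1. Being at least as steep as the line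
   [(1 + phi) * t] = t / phi, it stays below that line to the left of [phi]. *)
have := @rho_tangent m phi ltac:(lra) ltac:(lra); rewrite rho_golden => tan.
have := hnat_sqr_ge_below_golden phi_gt0 phi_sqr (_ : 0 < t < phi).
rewrite t0 tp => /(_ isT) bel.
apply: (@le_trans _ _ ((1 + phi) * t * hnat t)).
  apply: ler_wpM2r; first exact: ltW.
  have : 0 <= (1 - phi - drho m) * (phi - t) by rewrite mulr_ge0//; lra.
  have := phi_sqr; rewrite expr2; lra.
have h : 0 <= (1 + phi) * (phi * hnat (t * t) - t * hnat t) by rewrite mulr_ge0//; lra.
have := phi_sqr; rewrite expr2 => /(congr1 (fun u => u * hnat (t * t))); lra.
Qed.

End EntropyRatio.

(** * The two-point inequality on the closed square *)

Section TwoPoint.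
Variable R : realType.
Implicit Types (c m s t u v x y : R).

Lemma affine_ge0_endpoints u v :
  (forall t, 0 < t < 1 -> 0 <= (1 - t) * u + t * v) -> 0 <= u /\ 0 <= v.
Proof.
have half (a b : R) : (forall t, 0 < t < 1 -> 0 <= (1 - t) * a + t * b) -> 0 <= a.
  move=> h; rewrite leNgt; apply/negP => a0.
  have h1 := h (2^-1) ltac:(lra).
  have ab : 0 < b - a by lra.
  (* At this point the affine function takes the negative value a / 2. *)
  have t01 : 0 < - a / (2 * (b - a)) < 1.
    apply/andP; split; first by rewrite divr_gt0//; lra.
    by rewrite ltr_pdivrMr; lra.
  have := h _ t01.
  rewrite [X in 0 <= X](_ : _ = a / 2); last by field; lra.
  lra.
move=> h; split; first exact: half h.
by apply: (half v u) => t t01; have := h (1 - t) ltac:(lra); lra.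
Qed.

Lemma hnat0 : hnat (0 : R) = 0.
Proof. rewrite /hnat subr0 ln1; ring. Qed.

Lemma hnat1 : hnat (1 : R) = 0.
Proof. rewrite /hnat subrr ln1; ring. Qed.

Lemma hnatC x : hnat (1 - x) = hnat x.
Proof. rewrite /hnat (_ : 1 - (1 - x) = x); ring. Qed.

Lemma hnat_ge0 x : 0 <= x <= 1 -> 0 <= hnat x.
Proof.
move=> /andP[]; rewrite le_eqVlt => /predU1P[<- _|x0]; first by rewrite hnat0.
rewrite le_eqVlt => /predU1P[->|x1]; first by rewrite hnat1.
by rewrite ltW// hnat_gt0// x0.
Qed.

(** Nonnegativity of the kernel on the diagonal, read off the form at l = 0. *)
Lemma hnat_sqr_le t : 0 < t < 1 -> hnat (t * t) <= 2 * t * hnat t.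
Proof.
move=> t01; have := kernel_form_ge0 0 t01 t01.
by rewrite /kernel_form kernel_hnat//; lra.
Qed.

Lemma hnat_mul_tangent (phi : R) m : 0 < phi -> phi ^+ 2 = 1 - phi ->
  phi <= m < 1 -> exists2 s, 0 <= s & forall x y, 0 <= x <= 1 -> 0 <= y <= 1 ->
  (hnat (m * m) / hnat m + s * (x - m)) * hnat y
  + (hnat (m * m) / hnat m + s * (y - m)) * hnat x <= 2 * hnat (x * y).
Proof.
move=> phi0 phi2 m01; have [s s0 diag] := hnat_sqr_tangent phi0 phi2 m01.
exists s => //; set c := hnat (m * m) / hnat m in diag *.
(* The two diagonal bounds give c + s (t - m) <= 2 t on (0, 1). Extended to t = 0 and t = 1, this
   settles the boundary of the square. *)
have [|e0 e1] := @affine_ge0_endpoints (s * m - c) (2 - c - s * (1 - m)).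
  move=> t t01; have h := hnat_gt0 t01.
  have := le_trans (diag t t01) (hnat_sqr_le t01); rewrite ler_pM2r//; lra.
have left0 y : 0 <= y <= 1 -> (c + s * (0 - m)) * hnat y <= 0.
  by move=> /hnat_ge0 h; rewrite mulr_le0_ge0//; lra.
have left1 y : 0 <= y <= 1 -> (c + s * (1 - m)) * hnat y <= 2 * hnat y.
  by move=> /hnat_ge0 h; apply: ler_wpM2r => //; lra.
move=> x y x01 y01; have /andP[] := x01; rewrite le_eqVlt => /predU1P[<- _|x0].
  by rewrite mul0r hnat0 !mulr0 addr0 left0.
rewrite le_eqVlt => /predU1P[->|x1].
  by rewrite mul1r hnat1 !mulr0 addr0 left1.
have /andP[] := y01; rewrite le_eqVlt => /predU1P[<- _|y0].
  by rewrite mulr0 hnat0 !mulr0 add0r left0.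
rewrite le_eqVlt => /predU1P[->|y1].
  by rewrite mulr1 hnat1 !mulr0 add0r left1.
by apply: hnat_mul_ge => //; rewrite ?x0 ?y0.
Qed.

(** Gibbs' inequality. The support conditions exclude the case where [ln 0 = 0] would replace an
    infinite cross entropy. *)
Lemma hnat_cross u x : 0 <= u <= 1 -> 0 <= x <= 1 ->
  (0 < u -> 0 < x) -> (u < 1 -> x < 1) ->
  hnat u <= - (u * ln x) - (1 - u) * ln (1 - x).
Proof.
have gibbs (a b : R) : 0 <= a -> 0 <= b -> (0 < a -> 0 < b) ->
    - (a * ln a) <= - (a * ln b) + b - a.
  rewrite le_eqVlt => /predU1P[<- b0 _|a0 _ /(_ a0) b0]; first by rewrite !mul0r; lra.
  have := @le_ln1Dx R (b / a - 1); rewrite addrCA subrr addr0.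
  have ba : 0 < b / a by rewrite divr_gt0.
  move=> /(_ ltac:(lra)); rewrite ln_div ?posrE// => /(ler_wpM2l (ltW a0)).
  have -> : a * (b / a - 1) = b - a by field; lra.
  lra.
move=> /andP[u0 u1] /andP[x0 x1] ux ux'.
have := gibbs u x u0 x0 ux; have := gibbs (1 - u) (1 - x) ltac:(lra) ltac:(lra).
rewrite !subr_gt0 => /(_ ux'); rewrite /hnat; lra.
Qed.

End TwoPoint.

(** * Conditional entropy of a bit, atom by atom *)

Section FiniteEntropy.
Variable R : realType.

(* The contribution to a conditional entropy of an atom of mass [w], a part [f] of
   which carries a further bit; it vanishes for [w = 0]. *)
Definition kappa (w f : R) : R := w * hnat (f / w).

Lemma ratio01 (w f : R) : 0 <= f <= w -> 0 <= f / w <= 1.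
Proof.
move=> /andP[f0 fw]; rewrite divr_ge0 ?(le_trans f0)//=.
have := le_trans f0 fw; rewrite le_eqVlt => /predU1P[<-|w0]; first by rewrite invr0 mulr0.
by rewrite ler_pdivrMr// mul1r.
Qed.

Lemma kappa_ge0 (w f : R) : 0 <= f <= w -> 0 <= kappa w f.
Proof.
move=> fw; rewrite mulr_ge0 ?hnat_ge0 ?ratio01//.
by have /andP[/le_trans] := fw; exact.
Qed.

Lemma kappaE (w f : R) : 0 <= f <= w ->
  kappa w f = w * ln w - f * ln f - (w - f) * ln (w - f).
Proof.
rewrite /kappa => /andP[]; rewrite le_eqVlt => /predU1P[<- _|f0].
  by rewrite mul0r hnat0 subr0; ring.
rewrite le_eqVlt => /predU1P[->|fw].
  have [->|w0] := eqVneq w 0; first by rewrite subrr; ring.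
  by rewrite divff// hnat1 subrr; ring.
have w0 : 0 < w by apply: lt_trans fw.
rewrite /hnat (_ : 1 - f / w = (w - f) / w); last by field; lra.
by rewrite !ln_div ?posrE ?subr_gt0//; field; lra.
Qed.

(* Compare each summand with the cross entropy relative to the aggregate ratio. *)
Lemma kappa_sum (I : finType) (Q : pred I) (w f : I -> R) :
  (forall i, 0 <= f i <= w i) ->
  \sum_(i | Q i) kappa (w i) (f i)
  <= kappa (\sum_(i | Q i) w i) (\sum_(i | Q i) f i).
Proof.
move=> fw.
have f0 i : 0 <= f i by have /andP[] := fw i.
have w0 i : 0 <= w i by have /andP[a b] := fw i; exact: le_trans b.
have wf0 i : 0 <= w i - f i by have /andP[a b] := fw i; rewrite subr_ge0.
set V := \sum_(i | Q i) w i; set F := \sum_(i | Q i) f i.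
have VF : \sum_(i | Q i) (w i - f i) = V - F by rewrite sumrB.
have FV : 0 <= F <= V by rewrite sumr_ge0//= ler_sum// => i _; have /andP[] := fw i.
have wV i : Q i -> w i <= V.
  by move=> Qi; rewrite /V (bigD1 i)//= lerDl sumr_ge0.
have fF i : Q i -> f i <= F.
  by move=> Qi; rewrite /F (bigD1 i)//= lerDl sumr_ge0.
have wfV i : Q i -> w i - f i <= V - F.
  by move=> Qi; rewrite -VF (bigD1 i)//= lerDl sumr_ge0.
have V0 : 0 <= V by rewrite sumr_ge0.
have [VE|Vn] := eqVneq V 0.
  rewrite [leRHS]/kappa VE mul0r big1// => i Qi.
  have -> : w i = 0 by apply/eqP; rewrite eq_le w0 andbT -VE wV.
  by rewrite /kappa mul0r.
have Vgt : 0 < V by rewrite lt_neqAle eq_sym Vn.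
have x01 := ratio01 FV; set x := F / V in x01.
rewrite (_ : kappa V F = \sum_(i | Q i) (- (f i * ln x) - (w i - f i) * ln (1 - x))).
  apply: ler_sum => i Qi; rewrite /kappa.
  have [wE|wn] := eqVneq (w i) 0.
    have -> : f i = 0 by have := fw i; have := wE; lra.
    by rewrite wE; lra.
  have wp : 0 < w i by rewrite lt_neqAle eq_sym wn w0.
  apply: le_trans (ler_wpM2l (w0 i) (@hnat_cross R (f i / w i) x (ratio01 (fw i)) x01 _ _)) _.
  - rewrite pmulr_lgt0 ?invr_gt0// => fi.
    by rewrite divr_gt0// (lt_le_trans fi)// fF.
  - rewrite ltr_pdivrMr// mul1r -subr_gt0 => wfi.
    by rewrite ltr_pdivrMr// mul1r -subr_gt0 (lt_le_trans wfi)// wfV.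
  by rewrite le_eqVlt; apply/orP; left; apply/eqP; field; lra.
rewrite sumrB sumrN -!mulr_suml VF -/F /kappa /hnat -/x /x; field; lra.
Qed.

End FiniteEntropy.

(** * The chain rule for finite mass functions *)

Section ChainRule.
Variable R : realType.
Implicit Types (O F : finType).

Definition pmass O F (q : O -> R) (g : O -> F) (z : F) : R :=
  \sum_(w | g w == z) q w.

Definition fent O F (q : O -> R) (g : O -> F) : R :=
  - \sum_z pmass q g z * ln (pmass q g z).

(* In this form the entropy visibly depends only on the partition into fibres of [g]. *)
Lemma fentE O F (q : O -> R) (g : O -> F) :
  fent q g = - \sum_w q w * ln (\sum_(w' | g w' == g w) q w').
Proof.
rewrite /fent (partition_big g xpredT)//=; congr (- _); apply: eq_bigr => z _.
by rewrite mulr_suml; apply: eq_bigr => w /eqP <-.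
Qed.

Lemma eq_fent O F F' (q : O -> R) (g : O -> F) (g' : O -> F') :
  (forall v w, (g v == g w) = (g' v == g' w)) -> fent q g = fent q g'.
Proof.
move=> gg; rewrite !fentE; congr (- _); apply: eq_bigr => w _.
by congr (_ * ln _); apply: eq_bigl => v.
Qed.

Lemma fent_const O F (q : O -> R) (g : O -> F) :
  \sum_w q w = 1 -> (forall v w, g v = g w) -> fent q g = 0.
Proof.
move=> q1 gg; rewrite fentE big1 ?oppr0// => w _.
rewrite (eq_bigl xpredT) => [|v]; first by rewrite q1 ln1 mulr0.
by rewrite (gg v w) eqxx.
Qed.

Definition pmass_in O F (q : O -> R) (e : pred O) (g : O -> F) (z : F) : R :=
  \sum_(w | (g w == z) && e w) q w.

Lemma pmass_in_bounds O F (q : O -> R) (e : pred O) (g : O -> F) z :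
  (forall w, 0 <= q w) -> 0 <= pmass_in q e g z <= pmass q g z.
Proof.
move=> q0; rewrite /pmass (bigID e)/= sumr_ge0// lerDl sumr_ge0//.
Qed.

(** Chain rule: the sum is the conditional entropy of the bit [e] given [g]. *)
Lemma fent_pair O F (q : O -> R) (e : pred O) (g : O -> F) :
  (forall w, 0 <= q w) ->
  fent q (fun w => (g w, e w)) =
  fent q g + \sum_z kappa (pmass q g z) (pmass_in q e g z).
Proof.
move=> q0; rewrite /fent.
rewrite -(pair_big xpredT xpredT (fun z b =>
  pmass q (fun w => (g w, e w)) (z, b) * ln (pmass q (fun w => (g w, e w)) (z, b))))/=.
rewrite -!sumrN -big_split/=; apply: eq_bigr => z _.
rewrite big_bool/= kappaE ?pmass_in_bounds//.
have -> : pmass q (fun w => (g w, e w)) (z, true) = pmass_in q e g z.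
  by apply: eq_bigl => w; rewrite xpair_eqE eqb_id.
have -> : pmass q (fun w => (g w, e w)) (z, false) = pmass q g z - pmass_in q e g z.
  rewrite /pmass [in RHS](bigID e)/= addrAC subrr add0r.
  by apply: eq_bigl => w; rewrite xpair_eqE eqbF_neg.
ring.
Qed.

Definition prodw O (q : O -> R) (w : O * O) : R := q w.1 * q w.2.

Lemma sum_prodw O F (q : O -> R) (e : pred O) (g : O -> F) (Q : rel F) :
  \sum_(w : O * O | Q (g w.1) (g w.2) && (e w.1 && e w.2)) prodw q w =
  \sum_(z : F * F | Q z.1 z.2) pmass_in q e g z.1 * pmass_in q e g z.2.
Proof.
rewrite (partition_big (fun w : O * O => (g w.1, g w.2)) (fun z => Q z.1 z.2)); last first.
  by move=> w /andP[].
apply: eq_bigr => -[s t] /= Qst; rewrite /pmass_in big_distrlr/= pair_big/=.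
apply: eq_bigl => -[v w] /=; rewrite xpair_eqE.
case: (g v =P s) => [->|_]; last by rewrite !andbF.
by case: (g w =P t) => [->|_]; rewrite ?Qst ?andbT ?andbF.
Qed.

Lemma pmass_inT O F (q : O -> R) (g : O -> F) z : pmass_in q xpredT g z = pmass q g z.
Proof. by apply: eq_bigl => w; rewrite andbT. Qed.

(** One revealing step: [g] is the past of one set, [e] says that the new element is missing, and
    [J] combines two pasts into that of the union. *)
Lemma fent_pair_product_ge (phi m : R) O F (q : O -> R) (e : pred O)
    (g : O -> F) (J : F -> F -> F) :
  0 < phi -> phi ^+ 2 = 1 - phi -> phi <= m < 1 ->
  (forall w, 0 <= q w) -> \sum_w q w = 1 -> m <= \sum_(w | e w) q w ->
  hnat (m * m) / hnat m * (fent q (fun w => (g w, e w)) - fent q g) <=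
  fent (prodw q) (fun w => (J (g w.1) (g w.2), e w.1 && e w.2))
  - fent (prodw q) (fun w => J (g w.1) (g w.2)).
Proof.
move=> phi0 phi2 m01 q0 q1 me.
have [s s0 tan] := hnat_mul_tangent phi0 phi2 m01.
set c := hnat (m * m) / hnat m in tan *.
have qq0 w : 0 <= prodw q w by rewrite mulr_ge0.
rewrite !fent_pair// ![fent _ _ + _]addrC !addrK.
pose p z := pmass q g z; pose f z := pmass_in q e g z.
have fp z : 0 <= f z <= p z by exact: pmass_in_bounds.
have p0 z : 0 <= p z by have /andP[/le_trans] := fp z; exact.
have p1 : \sum_z p z = 1 by rewrite -q1 (partition_big g xpredT).
have fm : m <= \sum_z f z.
  apply: le_trans me _; rewrite (partition_big g xpredT)//= ler_sum// => z _.
  by rewrite /f /pmass_in; under eq_bigl do rewrite andbC.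
set K := \sum_z kappa (p z) (f z).
have K0 : 0 <= K by rewrite sumr_ge0// => z _; exact: kappa_ge0.
(* Conditioning on both pasts instead of their combination only lowers the entropy. *)
apply: (@le_trans _ _ (\sum_(z : F * F) kappa (p z.1 * p z.2) (f z.1 * f z.2))); last first.
  rewrite (partition_big (fun z : F * F => J z.1 z.2) xpredT)//=; apply: ler_sum => z _.
  have := @kappa_sum R _ (fun u : F * F => J u.1 u.2 == z) (fun u => p u.1 * p u.2)
    (fun u => f u.1 * f u.2).
  rewrite /pmass /pmass_in (sum_prodw q e g (fun s t => J s t == z)).
  have -> : \sum_(w : O * O | J (g w.1) (g w.2) == z) prodw q w =
      \sum_(u : F * F | J u.1 u.2 == z) p u.1 * p u.2.
    transitivity (\sum_(w : O * O | (J (g w.1) (g w.2) == z) && (true && true))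
        prodw q w).
      by apply: eq_bigl => w /=; rewrite andbT.
    rewrite (sum_prodw q xpredT g (fun s t => J s t == z)).
    by apply: eq_bigr => u _; rewrite !pmass_inT.
  apply => -[u v] /=; have /andP[? ?] := fp u; have /andP[? ?] := fp v.
  by rewrite mulr_ge0//= ler_pM.
rewrite -(ler_pM2l (_ : 0 < (2 : R)))// [leRHS]mulr_sumr.
apply: (@le_trans _ _ (\sum_(z : F * F)
  (p z.1 * (c + s * (f z.1 / p z.1 - m)) * kappa (p z.2) (f z.2)
   + kappa (p z.1) (f z.1) * (p z.2 * (c + s * (f z.2 / p z.2 - m)))))); last first.
  apply: ler_sum => -[u v] _ /=; rewrite /kappa -mulf_div.
  have := tan _ _ (ratio01 (fp u)) (ratio01 (fp v)).
  move=> /(ler_wpM2l (mulr_ge0 (p0 u) (p0 v))); lra.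
have pf z : p z * (c + s * (f z / p z - m)) = (c - s * m) * p z + s * f z.
  have [pz|pz] := eqVneq (p z) 0; last by field.
  have -> : f z = 0 by have := fp z; rewrite pz; lra.
  by rewrite pz; ring.
(* Averaging the affine factor gives c plus s times the excess of the mean over m; this uses
   [0 <= s]. *)
have sumpf : c <= \sum_z p z * (c + s * (f z / p z - m)).
  under eq_bigr do rewrite pf.
  by rewrite big_split/= -!mulr_sumr p1; have := ler_wpM2l s0 fm; lra.
rewrite big_split/=.
rewrite -(pair_big xpredT xpredT (fun u v =>
  p u * (c + s * (f u / p u - m)) * kappa (p v) (f v)))/=.
rewrite -(pair_big xpredT xpredT (fun u v =>
  kappa (p u) (f u) * (p v * (c + s * (f v / p v - m)))))/=.
rewrite -!big_distrlr/= -/K [K * _]mulrC.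
have := ler_wpM2r K0 sumpf; lra.
Qed.

End ChainRule.

(** * Induction over the ground set *)

Section UnionEntropy.
Variables (R : realType) (I : finType) (phi m : R) (q : {set I} -> R).
Hypotheses (phi_gt0 : 0 < phi) (phi_sqr : phi ^+ 2 = 1 - phi).
Hypotheses (m_bounds : phi <= m < 1) (q_ge0 : forall A, 0 <= q A).
Hypotheses (q_sum : \sum_A q A = 1).
Hypothesis m_le : forall i, m <= \sum_(A : {set I} | i \notin A) q A.

(** The new bit records absence, since absence from a union is the conjunction of two absences. *)
Let setIU1_eq (A B D : {set I}) i :
  (A :&: (i |: D) == B :&: (i |: D)) =
  ((A :&: D, i \notin A) == (B :&: D, i \notin B)).
Proof.
rewrite xpair_eqE; apply/eqP/andP => [E|[/eqP E /eqP e]].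
  split; apply/eqP.
    apply/setP => j; have /setP/(_ j) := E; rewrite !inE.
    by case: (j \in D); rewrite ?orbT ?andbT ?andbF.
  by have /setP/(_ i) := E; rewrite !inE eqxx/= !andbT => ->.
apply/setP => j; have /setP/(_ j) := E; rewrite !inE.
have [->|_] //= := eqVneq j i.
by move: e => /negb_inj ->.
Qed.

Lemma fent_setU_ge_on (s : seq I) :
  hnat (m * m) / hnat m * fent q (fun A => A :&: [set x in s])
  <= fent (prodw q) (fun w => (w.1 :|: w.2) :&: [set x in s]).
Proof.
have qq1 : \sum_w prodw q w = 1.
  rewrite -(pair_big xpredT xpredT (fun u v => q u * q v))/= -big_distrlr/=.
  by rewrite q_sum mulr1.
elim: s => [|i s IH].
  by rewrite !fent_const ?mulr0// => v w; apply/setP => j; rewrite !inE !andbF.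
have -> : [set x in i :: s] = i |: [set x in s] by apply/setP => j; rewrite !inE.
set D := [set x in s] in IH *.
rewrite (eq_fent q (fun A B => setIU1_eq A B D i)).
rewrite (eq_fent (prodw q) (g' := fun w =>
  ((w.1 :&: D) :|: (w.2 :&: D), (i \notin w.1) && (i \notin w.2)))); last first.
  by move=> v w; rewrite setIU1_eq !finset.setIUl !finset.in_setU !negb_or.
have := @fent_pair_product_ge R phi m _ _ q (fun A => i \notin A) (fun A => A :&: D)
  (fun A B => A :|: B) phi_gt0 phi_sqr m_bounds q_ge0 q_sum (m_le i).
rewrite /= (eq_fent (prodw q) (g := fun w => (w.1 :&: D) :|: (w.2 :&: D))
  (g' := fun w => (w.1 :|: w.2) :&: D)).
  by rewrite mulrBr; move: IH; lra.
by move=> v w; rewrite !finset.setIUl.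
Qed.

Lemma fent_setU_ge :
  hnat (m * m) / hnat m * fent q id <= fent (prodw q) (fun w => w.1 :|: w.2).
Proof.
have := fent_setU_ge_on (enum I).
have -> : [set x in enum I] = finset.setTfor I by apply/setP => i; rewrite !inE mem_enum.
rewrite (eq_fent q (g' := id)); last by move=> v w; rewrite !finset.setIT.
by rewrite (eq_fent (prodw q) (g' := fun w => w.1 :|: w.2))// => v w; rewrite !finset.setIT.
Qed.

End UnionEntropy.

(** * Laws of finitely valued random variables *)

Lemma fin_num_prob d (W : measurableType d) (R : realType)
    (P : probability W R) (U : set W) : measurable U -> P U \is a fin_num.
Proof. by move=> mU; exact: fin_num_measure. Qed.

Section FiniteLaw.
Context d (W : measurableType d) (R : realType) (F : finType) (Z : W -> F).
Hypothesis mZ : forall z, measurable (Z @^-1` [set z]).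

Lemma mem_consE z (s : seq F) :
  [set w | Z w \in z :: s] = Z @^-1` [set z] `|` [set w | Z w \in s].
Proof. by apply/seteqP; split => w /=; rewrite inE => /predU1P. Qed.

Lemma measurable_mem (s : seq F) : measurable [set w | Z w \in s].
Proof.
elim: s => [|z s mS]; last by rewrite mem_consE; exact: measurableU.
by rewrite (_ : [set w | _] = set0)//; apply/seteqP; split.
Qed.

Let mem_enumE (Q : pred F) : [set w | Z w \in enum Q] = [set w | Q (Z w)].
Proof. by apply/seteqP; split => w /=; rewrite mem_enum. Qed.

Lemma measurable_pred (Q : pred F) : measurable [set w | Q (Z w)].
Proof. by rewrite -mem_enumE; exact: measurable_mem. Qed.

Variable P : probability W R.

Lemma prob_mem (s : seq F) : uniq s ->
  fine (P [set w | Z w \in s]) = \sum_(z <- s) fine (P (Z @^-1` [set z])).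
Proof.
elim: s => [_|z s IH /= /andP[zs /IH PS]].
  rewrite (_ : [set w | _] = set0) ?measure0 ?big_nil//.
  by apply/seteqP; split.
have mS := measurable_mem s.
rewrite mem_consE big_cons -PS measureU//; first by rewrite fineD// fin_num_prob.
by apply/seteqP; split => // w /= [-> zs']; rewrite zs' in zs.
Qed.

Lemma prob_pred (Q : pred F) :
  fine (P [set w | Q (Z w)]) = \sum_(z | Q z) fine (P (Z @^-1` [set z])).
Proof.
by rewrite -big_enum -(prob_mem (enum_uniq Q)) mem_enumE.
Qed.

Lemma prob_sum1 : \sum_z fine (P (Z @^-1` [set z])) = 1.
Proof.
rewrite -(prob_pred xpredT) (_ : [set w | _] = setT) ?probability_setT//.
by apply/seteqP; split.
Qed.

End FiniteLaw.

(** * Transfer to the stated entropies *)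

Lemma binary_entropyE (R : realType) (b x : R) : binary_entropy b x = hnat x / ln b.
Proof. by rewrite /binary_entropy /hnat /logb; ring. Qed.

Lemma shannon_entropyE d (W : measurableType d) (R : realType)
    (P : probability W R) (F O : finType) (b : R) (Z : W -> F)
    (q : O -> R) (g : O -> F) :
  (forall z, fine (P (Z @^-1` [set z])) = pmass q g z) ->
  shannon_entropy P b Z = fent q g / ln b.
Proof.
move=> Zq; rewrite /shannon_entropy /fent /logb mulNr mulr_suml; congr (- _).
by apply: eq_bigr => z _; rewrite Zq mulrA.
Qed.

Theorem theorem1 (R : realType) (b : R) (hb : 1 < b)
    (n : nat) (hn : (1 <= n)%N)
    (d : measure_display) (W : measurableType d) (P : probability W R)
    (A B : {RV P >-> {set 'I_n}})
    (hindep : independent_rv A B)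
    (hdist : identically_distributed A B)
    (alpha : R) (halpha0 : 0 < alpha)
    (halpha : alpha <= (3 - Num.sqrt 5) / 2)
    (hA : forall i : 'I_n, (P [set w | i \in A w] <= alpha%:E)%E) :
  shannon_entropy P b (fun w => A w :|: B w) >=
    binary_entropy b (2 * alpha - alpha ^+ 2) / binary_entropy b alpha
      * shannon_entropy P b A.
Proof.
have mfib (X : {RV P >-> {set 'I_n}}) S : measurable (X @^-1` [set S]).
  by rewrite -[X in measurable X]setTI; exact: measurable_funP.
pose q S := fine (P (A @^-1` [set S])).
have qB S : fine (P (B @^-1` [set S])) = q S.
  by rewrite /q; congr fine; apply/esym; exact: (hdist [set S]).
have q0 S : 0 <= q S by rewrite fine_ge0.
have q1 : \sum_S q S = 1 by apply: prob_sum1.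
pose AB w := (A w, B w).
have ABE S : AB @^-1` [set S] = A @^-1` [set S.1] `&` B @^-1` [set S.2].
  by case: S => S T; apply/seteqP; split => w; rewrite /AB /=; move=> [-> ->].
have mAB S : measurable (AB @^-1` [set S]) by rewrite ABE; exact: measurableI.
have qAB S : fine (P (AB @^-1` [set S])) = prodw q S.
  by rewrite ABE hindep// fineM ?fin_num_prob// qB.
have ln_b : 0 < ln b by exact: ln_gt0.
have HA : shannon_entropy P b A = fent q id / ln b.
  by apply: shannon_entropyE => S; rewrite /pmass big_pred1_eq.
have HAB : shannon_entropy P b (fun w => A w :|: B w) =
    fent (prodw q) (fun S => S.1 :|: S.2) / ln b.
  apply: shannon_entropyE => S; rewrite /pmass -(eq_bigr _ (fun T _ => qAB T)).
  rewrite -(prob_pred mAB P (fun T => T.1 :|: T.2 == S)).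
  by congr (fine (P _)); apply/seteqP; split => w /= /eqP.
pose phi : R := (Num.sqrt 5 - 1) / 2.
have s5 : Num.sqrt 5 ^+ 2 = 5 :> R by rewrite sqr_sqrtr.
have s0 : 0 <= Num.sqrt 5 :> R by exact: sqrtr_ge0.
have phi0 : 0 < phi by rewrite /phi; nra.
have phi2 : phi ^+ 2 = 1 - phi by rewrite /phi; lra.
(* The bound on [alpha] is exactly [1 - phi]. *)
have m01 : phi <= 1 - alpha < 1 by rewrite /phi; lra.
have hm i : 1 - alpha <= \sum_(S : {set 'I_n} | i \notin S) q S.
  have := q1; rewrite (bigID (fun S : {set 'I_n} => i \in S))/= => <-.
  rewrite addrC lerBlDr lerD2l -(prob_pred (mfib A) P (fun S => i \in S)).
  rewrite -lee_fin fineK// fin_num_prob//.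
  exact: (measurable_pred (mfib A) (fun S => i \in S)).
have := fent_setU_ge phi0 phi2 m01 q0 q1 hm.
(* The symmetry of [hnat] under x -> 1 - x turns the ratio at m = 1 - alpha into the stated one. *)
rewrite hnatC (_ : (1 - alpha) * (1 - alpha) = 1 - (2 * alpha - alpha ^+ 2)); last by ring.
rewrite hnatC => main.
rewrite !binary_entropyE HA HAB mulrA ler_pM2r ?invr_gt0// (le_trans _ main)//.
rewrite le_eqVlt; apply/orP; left.
by apply/eqP; rewrite invf_div mulrA divfK// gt_eqF.
Qed.
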